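(* Let $X$ be a set and $d:X\times X\to[0,+\infty)$ a function which satisfies the reverse triangle inequality and distinguishes points, and assume that $(X,d)$ has no chronological boundary. Then $(X,d)$ is a Lorentzian metric space if and only if there is a relation $K\subset X\times X$ with $I\subset K\subset J$, and a topology on $X$ with respect to which $d$ is continuous (in the product topology) and $K(C)$ is compact for every compact set $C\subset X$.
   Context: Let $X$ be a set and $d:X\times X\to[0,+\infty)$ a function. Notation: $x\ll y$ iff $d(x,y)>0$; $I=\{(x,y)\in X\times X: x\ll y\}$; $I^+(x)=\{y: x\ll y\}$, $I^-(x)=\{y: y\ll x\}$; for $A\subset X$, $I^\pm(A)=\bigcup_{p\in A}I^\pm(p)$ and $I(A)=I^+(A)\cap I^-(A)$; $I(p,q):=I(\{p,q\})$. For $\epsilon>0$, $I_\epsilon=\{(x,y): d(x,y)\ge\epsilon\}$. The reverse triangle inequality means $d(x,z)\ge d(x,y)+d(y,z)$ whenever $d(x,y)>0$ and $d(y,z)>0$. ''$d$ distinguishes points'' means that for all $x\ne y$ there is $z\in X$ with $d(x,z)\ne d(y,z)$ or $d(z,x)\ne d(z,y)$. $(X,d)$ is a Lorentzian metric space if: (i) $d$ satisfies the reverse triangle inequality; (ii) there is a topology $T$ on $X$ such that $d$ is continuous in the product topology and, for every $x,y\in X$ and $\epsilon>0$, the set $I_\epsilon\cap(\overline{I(x,y)}\times\overline{I(x,y)})$ is compact; (iii) $d$ distinguishes points. $(X,d)$ has no chronological boundary if there is no $x\in X$ with $d(x,y)=0$ for all $y\in X$ and no $x\in X$ with $d(y,x)=0$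 for all $y\in X$. The (extended) causal relation is $J=\{(x,y)\in X\times X: d(p,y)\ge d(p,x)\text{ and }d(x,p)\ge d(y,p)\ \forall p\in X\}$. For a relation $K\subset X\times X$ and $C\subset X$: $K^+(C)=\{y: \exists x\in C,\ (x,y)\in K\}$, $K^-(C)=\{y:\exists x\in C,\ (y,x)\in K\}$, $K(C)=K^+(C)\cap K^-(C)$. *)

(* Defs.v *)
From HB Require Import structures.
From mathcomp Require Import all_boot all_order all_algebra.
From mathcomp Require Import all_classical all_reals all_analysis.

Set Implicit Arguments.
Unset Strict Implicit.
Unset Printing Implicit Defensive.

Import Order.TTheory GRing.Theory Num.Theory.
Import numFieldNormedType.Exports.

Local Open Scope classical_set_scope.
Local Open Scope ring_scope.

(* MathComp-Analysis attaches at most one canonical topology to a type, so a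
   topology on X that is to be quantified over is a value of the record
   [topology X], and [topologized T] is a copy of the type X whose canonical
   topology is T. *)
Record topology (X : Type) := Topology {
  is_open : set (set X);
  is_openT : is_open setT;
  is_openI : forall A B, is_open A -> is_open B -> is_open (A `&` B);
  is_open_bigcup : forall F : set (set X),
    F `<=` is_open -> is_open (\bigcup_(A in F) A)
}.

Definition topologized (X : Type) (T : topology X) : Type := X.

Section topologized.
Context (X : Type) (T : topology X).

Let is_open_bigU (I : Type) (f : I -> set X) :
  (forall i, is_open T (f i)) -> is_open T (\bigcup_i f i).
Proof.
move=> fo; have -> : \bigcup_i f i = \bigcup_(A in range f) A.
  by rewrite bigcup_image.
by apply: is_open_bigcup => _ [i _ <-].
Qed.

HB.instance Definition _ := gen_eqMixin (topologized T).
HB.instance Definition _ := gen_choiceMixin (topologized T).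
HB.instance Definition _ := isOpenTopological.Build (topologized T)
  (@is_openT X T) (@is_openI X T) is_open_bigU.

Lemma open_topologizedE : (open : set (set (topologized T))) = is_open T.
Proof. by []. Qed.

End topologized.

Section relations.
Context (X : Type) (K : set (X * X)).

Definition rel_future (C : set X) : set X :=
  [set y | exists2 x, C x & K (x, y)].
Definition rel_past (C : set X) : set X :=
  [set y | exists2 x, C x & K (y, x)].
Definition rel_hull (C : set X) : set X := rel_future C `&` rel_past C.

End relations.

Section lorentzian.
Context (R : realType) (X : Type) (d : X -> X -> R).

Definition chron : set (X * X) := [set p | 0 < d p.1 p.2].

Definition chron_ge (e : R) : set (X * X) := [set p | e <= d p.1 p.2].

Definition causal : set (X * X) :=
  [set xy | forall p, d p xy.1 <= d p xy.2 /\ d xy.2 p <= d xy.1 p].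

(* This is I({x, y}), hence symmetric in x and y. *)
Definition chron_hull2 (x y : X) : set X := rel_hull chron [set x; y].

Definition reverse_triangle := forall x y z,
  0 < d x y -> 0 < d y z -> d x y + d y z <= d x z.

Definition distinguishes_points := forall x y,
  x <> y -> exists z, d x z <> d y z \/ d z x <> d z y.

Definition no_chronological_boundary :=
  ~ (exists x, forall y, d x y = 0) /\ ~ (exists x, forall y, d y x = 0).

Definition dist_continuous (T : topology X) :=
  continuous (fun p : topologized T * topologized T => d p.1 p.2).

Definition lorentzian_metric_space :=
  [/\ reverse_triangle,
      exists T : topology X, dist_continuous T /\
        forall (x y : X) (e : R), 0 < e ->
          let clI := closure (chron_hull2 x y : set (topologized T)) in
          compact ((chron_ge e : set (topologized T * topologized T))
                   `&` (clI `*` clI)) &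
      distinguishes_points].

End lorentzian.

(* Main.v *)
(* The same topology works in both directions.  If K-hulls of compact sets are
   compact, then the closure of I(x, y) lies in K({x, y}), which is closed
   since T is Hausdorff, so the truncated chronological relation is closed in a
   compact product.  Conversely take K := J.  An ultrafilter on J(C) carries
   along points a(y) <= y <= b(y) of C, which converge to a0 and b0 in C.
   Without chronological boundary there are p' << p << a0 and b0 << q << q',
   and eventually d(p, y) >= d(p, a(y)) >= d(p, a0) / 2 with p and y in
   I(p', q'); compactness of the corresponding set of pairs makes y converge,
   and J is closed. *)
Require Import Defs.
From mathcomp Require Import all_boot all_order all_algebra.
From mathcomp Require Import all_classical all_reals all_analysis.

Import Order.TTheory GRing.Theory Num.Theory.
Import numFieldNormedType.Exports.

Local Open Scope classical_set_scope.
Local Open Scope ring_scope.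

Lemma fmap_ultra (T U : Type) (f : T -> U) (F : set_system T) :
  UltraFilter F -> UltraFilter (f @ F).
Proof.
move=> FU; split; first exact: fmap_proper_filter.
move=> G PG FG; apply/seteqP; split=> // A GA.
have [//|FnA] := in_ultra_setVsetC (f @^-1` A) FU.
suff: G set0 by move/filter_not_empty.
by rewrite -(setICr A); apply: filterI => //; apply: FG.
Qed.

Section lorentzian.
Context (R : realType) (X : Type) (d : X -> X -> R).
Hypothesis d_ge0 : forall x y, 0 <= d x y.
Hypothesis d_rti : reverse_triangle d.

Lemma chron_trans x y z : 0 < d x y -> 0 < d y z -> 0 < d x z.
Proof.
by move=> xy yz; apply: lt_le_trans (d_rti _ _ _ xy yz); apply: addr_gt0.
Qed.

(** Each inequality is trivial when its smaller side is 0; otherwise the reverse triangle inequality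
    applies through [x] or [y]. *)
Lemma chron_sub_causal : chron d `<=` causal d.
Proof.
move=> [x y]; rewrite /chron/= => xy p; split.
- have := d_ge0 p x; rewrite le_eqVlt => /predU1P[<- //|px].
  by apply: le_trans (d_rti _ _ _ px xy); rewrite lerDl ltW.
- have := d_ge0 y p; rewrite le_eqVlt => /predU1P[<- //|yp].
  by apply: le_trans (d_rti _ _ _ xy yp); rewrite lerDr ltW.
Qed.

Lemma chron_hull2_mem p q y :
  0 < d p y -> 0 < d y q -> chron_hull2 d p q y.
Proof.
by move=> py yq; split; [exists p; [left|] | exists q; [right|]].
Qed.

Lemma rel_hullS (K L : set (X * X)) (C : set X) :
  K `<=` L -> rel_hull K C `<=` rel_hull L C.
Proof.
by move=> KL y [[a Ca ay] [b Cb yb]]; split;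
  [exists a => //|exists b => //]; apply: KL.
Qed.

Lemma exists_past x : no_chronological_boundary d -> exists p, 0 < d p x.
Proof.
move=> [_ nobd]; apply: contrapT => /forallNP np; apply: nobd.
exists x => p; apply/eqP; rewrite eq_le d_ge0 andbT leNgt.
exact/negP/np.
Qed.

Lemma exists_future x : no_chronological_boundary d -> exists q, 0 < d x q.
Proof.
move=> [nobd _]; apply: contrapT => /forallNP np; apply: nobd.
exists x => p; apply/eqP; rewrite eq_le d_ge0 andbT leNgt.
exact/negP/np.
Qed.

Section topology.
Context (T : topology X).
Hypothesis d_cts : dist_continuous d T.

Lemma cvg_dist (Z : Type) (F : set_system Z) (u v : Z -> topologized T)
    (a b : topologized T) : Filter F ->
  u @ F --> a -> v @ F --> b -> (fun z => d (u z) (v z)) @ F --> d a b.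
Proof.
move=> FF ua vb.
exact: (cvg_comp (fun z => (u z, v z)) (fun p => d p.1 p.2)
  (cvg_pair ua vb) (d_cts (a, b))).
Qed.

(** Continuous real functions agree at non-separated points, because the reals are Hausdorff; the
    functions [d^~ z] and [d z] are continuous and together tell points apart. *)
Lemma hausdorff_topologized :
  distinguishes_points d -> hausdorff_space (topologized T).
Proof.
move=> d_sep p q pq; apply: contrapT => /d_sep[z].
have sep (f : topologized T -> R) : continuous f -> f p = f q.
  move=> fc; apply: (@norm_hausdorff _ R) => A B /fc fA /fc fB.
  by have [t [At Bt]] := pq _ _ fA fB; exists (f t).
have -> : d p z = d q z.
  apply: (sep (d^~ z)) => x.
  exact: (cvg_dist _ (nbhs x) id (fun=> z) x z _ cvg_id (cvg_cst _)).
have -> : d z p = d z q.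
  apply: (sep (d z)) => x.
  exact: (cvg_dist _ (nbhs x) (fun=> z) id z x _ (cvg_cst _) cvg_id).
by case.
Qed.

(** For each fixed [p], the inequalities defining [causal] are non-strict between convergent
    functions, so they pass to the limit. *)
Lemma causal_cvg (F : set_system X) (u v : X -> topologized T)
    (a b : topologized T) : ProperFilter F ->
  u @ F --> a -> v @ F --> b -> (\forall z \near F, causal d (u z, v z)) ->
  causal d (a, b).
Proof.
move=> FF ua vb uv p /=; split.
- apply: (@ler_cvg_to (topologized T) F _ R (fun z => d p (u z))
    (fun z => d p (v z))); [| |by apply: filterS uv => z /(_ p)[]];
  by apply: cvg_dist => //; exact: cvg_cst.
- apply: (@ler_cvg_to (topologized T) F _ R (fun z => d (v z) p)
    (fun z => d (u z) p)); [| |by apply: filterS uv => z /(_ p)[]];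
  by apply: cvg_dist => //; exact: cvg_cst.
Qed.

Lemma compact_causal_hull (C : set (topologized T)) :
  no_chronological_boundary d ->
  (forall (x y : X) (e : R), 0 < e ->
     let clI := closure (chron_hull2 d x y : set (topologized T)) in
     compact ((chron_ge d e : set (topologized T * topologized T))
              `&` (clI `*` clI))) ->
  compact C -> compact (rel_hull (causal d) C : set (topologized T)).
Proof.
move=> nobd cptI; rewrite compact_ultra => cptC F FU FH.
(* The implication makes the choice total: outside the hull, the value is [y] itself, as a
   default. *)
have /choice[a aP] : forall y : X, exists x : X,
    rel_hull (causal d) C y -> C x /\ causal d (x, y).
  move=> y; have [[[x Cx xy] _]|nHy] :=
    pselect (rel_hull (causal d) C y); first by exists x.
  by exists y.
have /choice[b bP] : forall y : X, exists x : X,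
    rel_hull (causal d) C y -> C x /\ causal d (y, x).
  move=> y; have [[_ [x Cx xy]]|nHy] :=
    pselect (rel_hull (causal d) C y); first by exists x.
  by exists y.
have [a0 [Ca0 aa0]] := cptC _ (fmap_ultra _ (topologized T) a _ FU)
  (filterS (fun y Hy => (aP y Hy).1) FH).
have [b0 [Cb0 bb0]] := cptC _ (fmap_ultra _ (topologized T) b _ FU)
  (filterS (fun y Hy => (bP y Hy).1) FH).
have [p pa0] := exists_past a0 nobd.
have [p' p'p] := exists_past p nobd.
have [q b0q] := exists_future b0 nobd.
have [q' qq'] := exists_future q nobd.
(* The threshold must be positive for [cptI] to apply, and strictly below [d p a0] so that
   [d p (a y)] eventually exceeds it. *)
have e0 : 0 < d p a0 / 2 by rewrite divr_gt0.
have ea0 : d p a0 / 2 < d p a0 by rewrite ltr_pdivrMr// ltr_pMr// ltr1n.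
pose clI := closure (chron_hull2 d p' q' : set (topologized T)).
have FS : \forall y \near F, ((chron_ge d (d p a0 / 2)
    : set (topologized T * topologized T)) `&` (clI `*` clI)) (p, y).
  have pa : (fun y => d p (a y)) @ F --> d p a0.
    exact: (cvg_dist _ F (fun=> p) a p a0 _ (cvg_cst _) aa0).
  have bq : (fun y => d (b y) q) @ F --> d b0 q.
    exact: (cvg_dist _ F b (fun=> q) b0 q _ bb0 (cvg_cst _)).
  apply: filterS3 FH (cvgr_gt _ bq _ b0q) (cvgr_gt _ pa _ ea0) => y Hy byq epa.
  have epy : d p a0 / 2 < d p y by apply: lt_le_trans ((aP y Hy).2 p).1.
  have yq : 0 < d y q by apply: lt_le_trans ((bP y Hy).2 q).2.
  have py := lt_trans e0 epy.
  have yq' := chron_trans _ _ _ yq qq'.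
  split; first exact: ltW.
  split; apply: subset_closure; apply: chron_hull2_mem => //.
  - exact: chron_trans py yq'.
  - exact: chron_trans p'p py.
have := cptI p' q' _ e0; rewrite /= compact_ultra.
(* Compactness is available for pairs only, so [F] is pushed onto the slice of pairs [(p, y)]; the
   second projection then recovers a limit of [F]. *)
have pU : UltraFilter (pair p @ F) := fmap_ultra _ _ (pair p) _ FU.
move=> /(_ _ pU FS)[[p0 y0] [_ py0]].
have Fy0 : F --> (y0 : topologized T).
  exact: (cvg_comp (pair p : topologized T -> topologized T * topologized T)
    snd py0 cvg_snd).
exists y0; split => //; split.
- exists a0 => //; apply: (causal_cvg _ _ _ _ _ _ aa0 Fy0).
  by apply: filterS FH => y /aP[].
- exists b0 => //; apply: (causal_cvg _ _ _ _ _ _ Fy0 bb0).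
  by apply: filterS FH => y /bP[].
Qed.

Lemma compact_chron_ge_hull2 (K : set (X * X)) (x y : X) (e : R) :
  distinguishes_points d -> chron d `<=` K ->
  (forall C : set (topologized T),
     compact C -> compact (rel_hull K C : set (topologized T))) ->
  let clI := closure (chron_hull2 d x y : set (topologized T)) in
  compact ((chron_ge d e : set (topologized T * topologized T))
           `&` (clI `*` clI)).
Proof.
move=> d_sep IK cptK clI.
have cptKxy : compact (rel_hull K [set x; y] : set (topologized T)).
  by apply: cptK; apply: compactU; exact: compact_set1.
have clKxy := compact_closed (hausdorff_topologized d_sep) cptKxy.
have cptI : compact clI.
  apply: subclosed_compact cptKxy _; first exact: closed_closure.
  (* With the closed hull replaced by its own closure, monotonicity of closure reduces the claim to
     an inclusion of hulls. *)
  rewrite [X in _ `<=` X]((closure_id _).1 clKxy).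
  by apply: closureS; exact: rel_hullS.
rewrite setIC; apply: compact_closedI; first exact: compact_setX.
by apply: preimage_closed (@closed_ge _ e) => p _; exact: d_cts.
Qed.

End topology.
End lorentzian.

Theorem theorem4p6 (R : realType) (X : Type) (d : X -> X -> R)
    (d_ge0 : forall x y, 0 <= d x y)
    (d_rti : reverse_triangle d)
    (d_sep : distinguishes_points d)
    (d_nobd : no_chronological_boundary d) :
  lorentzian_metric_space d <->
  exists (K : set (X * X)) (T : topology X),
    [/\ chron d `<=` K, K `<=` causal d, dist_continuous d T &
        forall C : set (topologized T),
          compact C -> compact (rel_hull K C : set (topologized T))].
Proof.
split=> [[_ [T [d_cts cptI]] _]|[K [T [IK _ d_cts cptK]]]].
  exists (causal d), T; split=> //; first exact: chron_sub_causal.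
  by move=> C; exact: compact_causal_hull.
split=> //; exists T; split=> // x y e _.
exact: compact_chron_ge_hull2 IK cptK.
Qed.
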